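(* Let $F$ be a field of characteristic $2$. If three octonion $F$-algebras share a biquadratic purely inseparable field extension of $F$, then they also share a quaternion subalgebra.
   Context: A collection of $F$-algebras shares a given $F$-algebra $B$ if each algebra in the collection contains an $F$-subalgebra isomorphic to $B$; the three algebras share a quaternion subalgebra if there is a quaternion $F$-algebra that they share. A biquadratic purely inseparable field extension of $F$ is a field extension of degree $4$ of the form $F[\sqrt{\beta},\sqrt{\gamma}]$ with $\beta,\gamma\in F^\times$. A quaternion algebra over $F$ is of the form $[\alpha,\beta)_{2,F}=F\langle x,y : x^2-x=\alpha,\ y^2=\beta,\ yxy^{-1}=x+1\rangle$ with $\alpha\in F$, $\beta\in F^\times$. An octonion algebra over $F$ is an algebra (not associative) of the form $Q+Qz$ obtained by the Cayley–Dickson doubling process from a quaternion algebra $Q$ with canonical involution $\sigma$, with $z^2=\gamma\in F^\times$ and $z\ell=\ell^\sigma z$ for every $\ell\in Q$. *)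

(* Defs.v *)
From HB Require Import structures.
From mathcomp Require Import all_boot all_order all_algebra all_field.
From mathcomp Require Import ring.

Set Implicit Arguments.
Unset Strict Implicit.
Unset Printing Implicit Defensive.

Import GRing.Theory.
Local Open Scope ring_scope.

(* MathComp has no structure for algebras whose product is not assumed
   associative, so we declare one: unital, with a bilinear product. *)
HB.mixin Record Lmodule_isNonAssocAlgebra (F : fieldType) A
    of GRing.Lmodule F A := {
  na_one : A;
  na_mul : A -> A -> A;
  na_mulDl : left_distributive na_mul +%R;
  na_mulDr : right_distributive na_mul +%R;
  na_scaleAl : forall (a : F) (x y : A),
    a *: na_mul x y = na_mul (a *: x) y;
  na_scaleAr : forall (a : F) (x y : A),
    a *: na_mul x y = na_mul x (a *: y);
  na_mul1l : left_id na_one na_mul;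
  na_mul1r : right_id na_one na_mul
}.

#[short(type="naAlgType")]
HB.structure Definition NonAssocAlgebra (F : fieldType) :=
  { A of GRing.Lmodule F A & Lmodule_isNonAssocAlgebra F A }.

Arguments na_one {F s}.

(* An associative algebra, such as a quaternion algebra or a field extension,
   seen in the above structure. *)
Definition assoc_na (B : Type) : Type := B.

Section AssocNonAssoc.
Variables (F : fieldType) (B : algType F).

HB.instance Definition _ := GRing.Lmodule.copy (assoc_na B) B.
HB.instance Definition _ :=
  Lmodule_isNonAssocAlgebra.Build F (assoc_na B)
    (@mulrDl B) (@mulrDr B) (@scalerAl F B) (@scalerAr F B)
    (@mul1r B) (@mulr1 B).
End AssocNonAssoc.

Definition na_morphism (F : fieldType) (A B : naAlgType F) (f : A -> B) : Prop :=
  [/\ linear f, f na_one = na_one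
    & forall x y, f (na_mul x y) = na_mul (f x) (f y)].

Definition na_isomorphic (F : fieldType) (A B : naAlgType F) : Prop :=
  exists f : A -> B, na_morphism f /\ bijective f.

Definition is_subalgebra (F : fieldType) (A : naAlgType F) (S : A -> Prop) : Prop :=
  [/\ S na_one, forall (a : F) x y, S x -> S y -> S (a *: x + y)
    & forall x y, S x -> S y -> S (na_mul x y)].

Definition contains_subalgebra (F : fieldType) (A B : naAlgType F) : Prop :=
  exists S : A -> Prop, is_subalgebra S /\
    exists f : B -> A,
      [/\ na_morphism f, injective f & forall x, S x <-> exists b, f b = x].

Definition shares (F : fieldType) (I : Type) (A : I -> naAlgType F)
    (B : naAlgType F) : Prop :=
  forall i, contains_subalgebra (A i) B.

(* [quaternion alpha beta] is the algebra [alpha, beta), on its basis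
   1, x, y, xy.  The product is computed from
     x^2 = x + alpha,  y^2 = beta,  y x = (1 - x) y;
   writing 1 - x rather than x + 1 makes it associative over any field, and
   the two agree in characteristic 2.  The lemmas [quat_relations],
   [quat_universal] and [quat_universal_unique] below show that in
   characteristic 2 it is the algebra with the presentation
   <x, y : x^2 - x = alpha, y^2 = beta, y x = (x + 1) y>. *)
Record quaternion (F : fieldType) (alpha beta : F) := Quaternion
  { coef1 : F; coefx : F; coefy : F; coefxy : F }.

Arguments Quaternion {F} alpha beta.

Section QuaternionTheory.
Variables (F : fieldType) (alpha beta : F).
Local Notation Q := (quaternion alpha beta).
Local Notation mkQ := (Quaternion alpha beta).

Definition quat_to_tuple (q : Q) := (coef1 q, coefx q, coefy q, coefxy q).
Definition quat_of_tuple (t : F * F * F * F) : Q :=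
  let: (p, r, s, t) := t in mkQ p r s t.
Lemma quat_tupleK : cancel quat_to_tuple quat_of_tuple.
Proof. by case. Qed.
HB.instance Definition _ := Choice.copy Q (can_type quat_tupleK).

Lemma quat_eq (q r : Q) :
  coef1 q = coef1 r -> coefx q = coefx r -> coefy q = coefy r ->
  coefxy q = coefxy r -> q = r.
Proof. by case: q r => [????] [????] /= -> -> -> ->. Qed.

Definition quat_add (q r : Q) : Q :=
  mkQ (coef1 q + coef1 r) (coefx q + coefx r)
      (coefy q + coefy r) (coefxy q + coefxy r).
Definition quat_opp (q : Q) : Q :=
  mkQ (- coef1 q) (- coefx q) (- coefy q) (- coefxy q).
Definition quat_scale (a : F) (q : Q) : Q :=
  mkQ (a * coef1 q) (a * coefx q) (a * coefy q) (a * coefxy q).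

Definition quat_mul (q r : Q) : Q :=
  let: Quaternion a b c d := q in let: Quaternion a' b' c' d' := r in
  mkQ (a * a' + alpha * b * b' + beta * (c * (c' + d') - alpha * d * d'))
      (a * b' + b * a' + b * b' + beta * (d * c' - c * d'))
      (a * c' + alpha * b * d' + c * (a' + b') - alpha * d * b')
      (a * d' + b * c' + b * d' + d * a' - c * b').

Fact quat_addA : associative quat_add.
Proof. by move=> p q r; apply: quat_eq; rewrite /= addrA. Qed.
Fact quat_addC : commutative quat_add.
Proof. by move=> p q; apply: quat_eq; rewrite /= addrC. Qed.
Fact quat_add0 : left_id (mkQ 0 0 0 0) quat_add.
Proof. by move=> p; apply: quat_eq; rewrite /= add0r. Qed.
Fact quat_addN : left_inverse (mkQ 0 0 0 0) quat_opp quat_add.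
Proof. by move=> p; apply: quat_eq; rewrite /= addNr. Qed.
HB.instance Definition _ :=
  GRing.isZmodule.Build Q quat_addA quat_addC quat_add0 quat_addN.

Fact quat_mulA : associative quat_mul.
Proof. by move=> [????] [????] [????]; apply: quat_eq => /=; ring. Qed.
Fact quat_mul1l : left_id (mkQ 1 0 0 0) quat_mul.
Proof. by move=> [????]; apply: quat_eq => /=; ring. Qed.
Fact quat_mul1r : right_id (mkQ 1 0 0 0) quat_mul.
Proof. by move=> [????]; apply: quat_eq => /=; ring. Qed.
Fact quat_mulDl : left_distributive quat_mul +%R.
Proof. by move=> [????] [????] [????]; apply: quat_eq => /=; ring. Qed.
Fact quat_mulDr : right_distributive quat_mul +%R.
Proof. by move=> [????] [????] [????]; apply: quat_eq => /=; ring. Qed.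
Fact quat_one_neq0 : mkQ 1 0 0 0 != 0.
Proof. by apply/eqP => -[] /eqP; rewrite oner_eq0. Qed.
HB.instance Definition _ :=
  GRing.Zmodule_isNzRing.Build Q quat_mulA quat_mul1l quat_mul1r
    quat_mulDl quat_mulDr quat_one_neq0.

Fact quat_scaleA a b (q : Q) :
  quat_scale a (quat_scale b q) = quat_scale (a * b) q.
Proof. by apply: quat_eq => /=; rewrite mulrA. Qed.
Fact quat_scale1 : left_id 1 quat_scale.
Proof. by move=> q; apply: quat_eq => /=; rewrite mul1r. Qed.
Fact quat_scaleDr : right_distributive quat_scale +%R.
Proof. by move=> a q r; apply: quat_eq => /=; rewrite mulrDr. Qed.
Fact quat_scaleDl (q : Q) : {morph quat_scale^~ q : a b / a + b}.
Proof. by move=> a b; apply: quat_eq => /=; rewrite mulrDl. Qed.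
HB.instance Definition _ :=
  GRing.Zmodule_isLmodule.Build F Q
    quat_scaleA quat_scale1 quat_scaleDr quat_scaleDl.

Fact quat_scaleAl (a : F) (q r : Q) : a *: (q * r) = (a *: q) * r.
Proof. by case: q r => [????] [????]; apply: quat_eq => /=; ring. Qed.
HB.instance Definition _ := GRing.Lmodule_isLalgebra.Build F Q quat_scaleAl.
Fact quat_scaleAr (a : F) (q r : Q) : a *: (q * r) = q * (a *: r).
Proof. by case: q r => [????] [????]; apply: quat_eq => /=; ring. Qed.
HB.instance Definition _ := GRing.Lalgebra_isAlgebra.Build F Q quat_scaleAr.

Definition quatx : Q := mkQ 0 1 0 0.
Definition quaty : Q := mkQ 0 0 1 0.

(* The canonical involution: it sends x to 1 - x (that is, x + 1) and fixes F,
   and in characteristic 2 it also fixes y and xy. *)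
Definition quat_conj (q : Q) : Q :=
  mkQ (coef1 q + coefx q) (- coefx q) (- coefy q) (- coefxy q).

Lemma quat_conjK : involutive quat_conj.
Proof. by move=> [????]; apply: quat_eq => /=; ring. Qed.

Lemma quat_conjM (q r : Q) : quat_conj (q * r) = quat_conj r * quat_conj q.
Proof. by case: q r => [????] [????]; apply: quat_eq => /=; ring. Qed.

Lemma quat_trace (q : Q) :
  q + quat_conj q = (coef1 q + (coef1 q + coefx q))%:A.
Proof. by case: q => [????]; apply: quat_eq => /=; ring. Qed.

Lemma quat_norm (q : Q) : exists a : F, q * quat_conj q = a%:A.
Proof.
case: q => [a b c d].
exists (a ^+ 2 + a * b - alpha * b ^+ 2
        - beta * (c ^+ 2 + c * d - alpha * d ^+ 2)).
by apply: quat_eq => /=; ring.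
Qed.

Lemma quat_basis (a b c d : F) :
  mkQ a b c d = a%:A + b *: quatx + c *: quaty + d *: (quatx * quaty).
Proof. by apply: quat_eq => /=; ring. Qed.

Hypothesis char2 : 2 \in [pchar F].

Lemma quat_relations :
  [/\ quatx ^+ 2 - quatx = alpha%:A, quaty ^+ 2 = beta%:A
    & quaty * quatx = (quatx + 1) * quaty].
Proof.
have two0 : (1 : F) = - 1 by rewrite (oppr_pchar2 char2).
split; rewrite ?expr2; apply: quat_eq => /=; try ring.
by rewrite !(mul0r, mul1r, mulr1, mulr0, addr0, add0r, sub0r, subr0) -two0.
Qed.

Section Universal.
Variables (B : algType F) (X Y : B).

Lemma quat_universal_unique (f g : {lrmorphism Q -> B}) :
  f quatx = g quatx -> f quaty = g quaty -> f =1 g.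
Proof.
move=> ex ey [a b c d].
by rewrite quat_basis !raddfD /= !linearZ /= !rmorphM !rmorph1 /= ex ey.
Qed.

Let L (q : Q) : B :=
  (coef1 q)%:A + coefx q *: X + coefy q *: Y + coefxy q *: (X * Y).

Hypotheses (eX : X ^+ 2 - X = alpha%:A) (eY : Y ^+ 2 = beta%:A)
  (eYX : Y * X = (X + 1) * Y).

Let LZ k q : L (k *: q) = k *: L q.
Proof. by case: q => [a b c d]; rewrite /L /= !scalerDr !scalerA. Qed.

Let LD q r : L (q + r) = L q + L r.
Proof.
case: q r => [a b c d] [a' b' c' d']; rewrite /L /= !scalerDl.
by rewrite [LHS](AC (2*2*2*2) ((1*3*5*7)*(2*4*6*8))).
Qed.

Let L_x q : L (quatx * q) = X * L q.
Proof.
have eXX : X * X = X + alpha%:A by rewrite -eX addrC subrK -expr2.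
case: q => [a b c d].
have -> : quatx * mkQ a b c d = mkQ (b * alpha) (a + b) (d * alpha) (c + d).
  by apply: quat_eq => /=; ring.
rewrite /L /= !mulrDr -!scalerAr !mulr1 mulrA eXX mulrDl -scalerAl mul1r.
rewrite !scalerDr !scalerDl !scalerA.
by rewrite [RHS](AC (1*2*1*2) (3*(1*2)*6*(4*5))).
Qed.

Let L_y q : L (quaty * q) = Y * L q.
Proof.
case: q => [a b c d].
have e2 (u : F) : - u = u by rewrite (oppr_pchar2 char2).
have -> : quaty * mkQ a b c d
          = mkQ (c * beta + d * beta) (d * beta) (a + b) b.
  by apply: quat_eq => /=; first [ring | rewrite -[RHS]e2; ring].
rewrite /L /= !mulrDr -!scalerAr !mulr1 mulrA eYX mulrDl mul1r mulrDl -mulrA.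
rewrite -expr2 eY -scalerAr mulr1 !scalerDr !scalerDl !scalerA.
by rewrite [RHS](AC (1*2*1*2) (4*6*5*(1*3)*2)).
Qed.

Let L_M : monoid_morphism L.
Proof.
split; first by rewrite /L /= !scale0r !addr0 scale1r.
move=> [a b c d] r; rewrite {1}quat_basis !mulrDl -!scalerAl -mulrA mul1r.
by rewrite !(LD, LZ, L_x, L_y) /= mul1r mulrA.
Qed.

Lemma quat_universal :
  exists f : {lrmorphism Q -> B}, f quatx = X /\ f quaty = Y.
Proof.
have Llin : linear L by move=> k q r; rewrite LD LZ.
pose LL := GRing.isLinear.Build F Q B _ L Llin.
pose LM := GRing.isMonoidMorphism.Build Q B L L_M.
pose f : {lrmorphism Q -> B} := HB.pack L LL LM.
exists f; rewrite /= /L /=.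
by rewrite !(scale0r, scale1r, add0r, addr0).
Qed.
End Universal.

End QuaternionTheory.

Definition is_quaternion_algebra (F : fieldType) (B : naAlgType F) : Prop :=
  exists alpha beta : F,
    beta != 0 /\ na_isomorphic (assoc_na (quaternion alpha beta)) B.

(* The Cayley-Dickson double Q + Qz of the quaternion algebra
   Q = [alpha, beta); [Octonion q r] stands for q + r z.  The product is
     (q + r z) (s + t z) = (q s + gamma t^sigma r) + (t q + r s^sigma) z. *)
Record octonion (F : fieldType) (alpha beta gamma : F) := Octonion
  { oct_fst : quaternion alpha beta; oct_snd : quaternion alpha beta }.

Arguments Octonion {F alpha beta} gamma.

Section OctonionTheory.
Variables (F : fieldType) (alpha beta gamma : F).
Local Notation Q := (quaternion alpha beta).
Local Notation O := (octonion alpha beta gamma).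
Local Notation mkO := (@Octonion F alpha beta gamma).

Definition oct_to_pair (o : O) := (oct_fst o, oct_snd o).
Definition oct_of_pair (p : Q * Q) : O := mkO p.1 p.2.
Lemma oct_pairK : cancel oct_to_pair oct_of_pair.
Proof. by case. Qed.
HB.instance Definition _ := Choice.copy O (can_type oct_pairK).

Lemma oct_eq (u v : O) :
  oct_fst u = oct_fst v -> oct_snd u = oct_snd v -> u = v.
Proof. by case: u v => [??] [??] /= -> ->. Qed.

Definition oct_add (u v : O) : O :=
  mkO (oct_fst u + oct_fst v) (oct_snd u + oct_snd v).
Definition oct_opp (u : O) : O := mkO (- oct_fst u) (- oct_snd u).
Definition oct_scale (a : F) (u : O) : O :=
  mkO (a *: oct_fst u) (a *: oct_snd u).
Definition oct_mul (u v : O) : O :=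
  let: Octonion q r := u in let: Octonion s t := v in
  mkO (q * s + gamma *: (quat_conj t * r)) (t * q + r * quat_conj s).

Fact oct_addA : associative oct_add.
Proof. by move=> u v w; apply: oct_eq; rewrite /= addrA. Qed.
Fact oct_addC : commutative oct_add.
Proof. by move=> u v; apply: oct_eq; rewrite /= addrC. Qed.
Fact oct_add0 : left_id (mkO 0 0) oct_add.
Proof. by move=> u; apply: oct_eq; rewrite /= add0r. Qed.
Fact oct_addN : left_inverse (mkO 0 0) oct_opp oct_add.
Proof. by move=> u; apply: oct_eq; rewrite /= addNr. Qed.
HB.instance Definition _ :=
  GRing.isZmodule.Build O oct_addA oct_addC oct_add0 oct_addN.

Fact oct_scaleA a b (u : O) : oct_scale a (oct_scale b u) = oct_scale (a * b) u.
Proof. by apply: oct_eq; rewrite /= scalerA. Qed.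
Fact oct_scale1 : left_id 1 oct_scale.
Proof. by move=> u; apply: oct_eq; rewrite /= scale1r. Qed.
Fact oct_scaleDr : right_distributive oct_scale +%R.
Proof. by move=> a u v; apply: oct_eq; rewrite /= scalerDr. Qed.
Fact oct_scaleDl (u : O) : {morph oct_scale^~ u : a b / a + b}.
Proof. by move=> a b; apply: oct_eq; rewrite /= scalerDl. Qed.
HB.instance Definition _ :=
  GRing.Zmodule_isLmodule.Build F O
    oct_scaleA oct_scale1 oct_scaleDr oct_scaleDl.

Let conjD (q r : Q) : quat_conj (q + r) = quat_conj q + quat_conj r.
Proof. by apply: quat_eq => /=; ring. Qed.
Let conjZ (a : F) (q : Q) : quat_conj (a *: q) = a *: quat_conj q.
Proof. by apply: quat_eq => /=; ring. Qed.
Let conj0 : quat_conj (0 : Q) = 0.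
Proof. by apply: quat_eq => /=; ring. Qed.
Let conj1 : quat_conj (1 : Q) = 1.
Proof. by apply: quat_eq => /=; ring. Qed.

Fact oct_mulDl : left_distributive oct_mul +%R.
Proof.
move=> [q r] [q' r'] [s t]; apply: oct_eq => /=.
  by rewrite mulrDl mulrDr scalerDr addrACA.
by rewrite mulrDl mulrDr addrACA.
Qed.
Fact oct_mulDr : right_distributive oct_mul +%R.
Proof.
move=> [q r] [s t] [s' t']; apply: oct_eq => /=; rewrite conjD.
  by rewrite mulrDl mulrDr scalerDr addrACA.
by rewrite mulrDl mulrDr addrACA.
Qed.
Fact oct_scaleAl (a : F) (u v : O) :
  a *: oct_mul u v = oct_mul (a *: u) v.
Proof.
case: u v => [q r] [s t]; apply: oct_eq => /=; rewrite scalerDr.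
  by rewrite -scalerAl -scalerAr !scalerA mulrC.
by rewrite -scalerAl -scalerAr.
Qed.
Fact oct_scaleAr (a : F) (u v : O) :
  a *: oct_mul u v = oct_mul u (a *: v).
Proof.
case: u v => [q r] [s t]; apply: oct_eq => /=; rewrite scalerDr conjZ.
  by rewrite -scalerAl -scalerAr !scalerA mulrC.
by rewrite -scalerAl -scalerAr.
Qed.
Fact oct_mul1l : left_id (mkO 1 0) oct_mul.
Proof.
by move=> [s t]; apply: oct_eq => /=;
   rewrite ?mulr0 ?mul0r ?scaler0 ?mul1r ?mulr1 addr0.
Qed.
Fact oct_mul1r : right_id (mkO 1 0) oct_mul.
Proof.
move=> [s t]; apply: oct_eq => /=; rewrite ?conj0 ?conj1 !mul0r ?mulr1.
  by rewrite scaler0 addr0.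
by rewrite add0r.
Qed.
HB.instance Definition _ :=
  Lmodule_isNonAssocAlgebra.Build F O oct_mulDl oct_mulDr
    oct_scaleAl oct_scaleAr oct_mul1l oct_mul1r.

Definition octz : O := mkO 0 1.

Lemma oct_decomp (q r : Q) : mkO q r = mkO q 0 + na_mul (mkO r 0) octz.
Proof.
rewrite /na_mul /=; apply: oct_eq => /=.
  by rewrite conj1 mulr0 mulr0 scaler0 !addr0.
by rewrite mul1r mul0r addr0 add0r.
Qed.

Lemma oct_mul_quat (q s : Q) : na_mul (mkO q 0) (mkO s 0) = mkO (q * s) 0.
Proof.
by rewrite /na_mul /=; apply: oct_eq => /=;
   rewrite ?mulr0 ?mul0r ?scaler0 addr0.
Qed.

Lemma octz_sqr : na_mul octz octz = gamma *: na_one.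
Proof.
rewrite /na_mul /=; apply: oct_eq => /=.
  by rewrite conj1 mul0r mulr1 add0r.
by rewrite conj0 !mulr0 addr0 scaler0.
Qed.

Lemma octz_quat (l : Q) :
  na_mul octz (mkO l 0) = na_mul (mkO (quat_conj l) 0) octz.
Proof.
rewrite /na_mul /=; apply: oct_eq => /=.
  by rewrite conj0 !mul0r !mulr0 scaler0.
by rewrite !mul0r !mul1r add0r addr0.
Qed.

End OctonionTheory.

Definition is_octonion_algebra (F : fieldType) (A : naAlgType F) : Prop :=
  exists alpha beta gamma : F,
    [/\ beta != 0, gamma != 0 & na_isomorphic (octonion alpha beta gamma) A].

Definition is_biquadratic_insep (F : fieldType) (K : fieldExtType F) : Prop :=
  \dim {:K} = 4 /\
  exists (beta gamma : F) (u v : K),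
    [/\ beta != 0, gamma != 0, u ^+ 2 = beta%:A, v ^+ 2 = gamma%:A
      & <<<<1; u>>; v>>%VS = {:K}%VS].

(* Main.v *)
Require Import Defs.
From HB Require Import structures.
From mathcomp Require Import all_boot all_order all_algebra all_field.
From mathcomp Require Import ring.

(* Let [T] and [N] be the trace and norm of an octonion algebra containing
   [K = F[u, v]], where [u^2 = b] and [v^2 = c].  An element [x] with [T x = 1]
   and [T (x u) = 0] generates with [u] a copy of the quaternion algebra
   [N x, b), so it suffices to find such [x_i] of equal norms in the three
   algebras.  As [T] vanishes on [K], for [k] in [K] we have
   [N (x + k) = N x + k^2 + T (x k)], and [k^2] is a scalar which does not
   depend on the algebra.  The functional [k |-> T (x_i k)] on [K] can be
   prescribed; choosing it to be 1 at [1], 0 at [u], and (0,0), (1,0), (0,1) at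
   [(v, u v)] for the three algebras, the norms of the [x_i + r v + s u v]
   become equal for suitable scalars [r] and [s]. *)

Set Implicit Arguments.
Unset Strict Implicit.
Unset Printing Implicit Defensive.
Import GRing.Theory.
Local Open Scope ring_scope.

(** * Embeddings of algebras and their transport along isomorphisms *)

(** The subset in [contains_subalgebra] can only be the image of the embedding, so the injective
    morphism carries all the information. *)
Lemma contains_subalgebraP (F : fieldType) (A B : naAlgType F) :
  contains_subalgebra A B <-> exists2 f : B -> A, na_morphism f & injective f.
Proof.
split=> [[_ [_ [f [fM f_inj _]]]] | [f fM f_inj]]; first by exists f.
have [flin f1 fmul] := fM; exists (fun x => exists b, f b = x).
split; last by exists f.
split=> [|k _ _ [x <-] [y <-]|_ _ [x <-] [y <-]].
- by exists na_one.
- by exists (k *: x + y); rewrite flin.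
- by exists (na_mul x y); rewrite fmul.
Qed.

Lemma na_morphism_comp (F : fieldType) (A B C : naAlgType F)
    (f : B -> C) (g : A -> B) :
  na_morphism f -> na_morphism g -> na_morphism (f \o g).
Proof.
move=> [flin f1 fM] [glin g1 gM]; split=> [k x y||x y] /=.
- by rewrite glin flin.
- by rewrite g1 f1.
- by rewrite gM fM.
Qed.

Lemma na_morphism_can (F : fieldType) (A B : naAlgType F)
    (f : A -> B) (g : B -> A) :
  cancel f g -> cancel g f -> na_morphism f -> na_morphism g.
Proof.
move=> fK gK [flin f1 fM]; have f_inj := can_inj fK.
split=> [k x y||x y]; apply: f_inj.
- by rewrite flin !gK.
- by rewrite f1 gK.
- by rewrite fM !gK.
Qed.

Lemma contains_subalgebra_iso (F : fieldType) (A A' B : naAlgType F) :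
  na_isomorphic A A' -> contains_subalgebra A B <-> contains_subalgebra A' B.
Proof.
move=> [f [fM [g fK gK]]]; have gM := na_morphism_can fK gK fM.
split=> /contains_subalgebraP[h hM h_inj]; apply/contains_subalgebraP.
  by exists (f \o h); [apply: na_morphism_comp | apply: inj_comp (can_inj fK) _].
by exists (g \o h); [apply: na_morphism_comp | apply: inj_comp (can_inj gK) _].
Qed.

(** * Trace and norm of an octonion algebra, and the quaternion subalgebras they detect *)

Section OctonionTraceNorm.
Variables (F : fieldType) (alpha beta gamma : F).
Local Notation Q := (quaternion alpha beta).
Local Notation O := (octonion alpha beta gamma).

(** The scalar whose existence [quat_norm] asserts, written in coordinates so that [ring]
    applies. *)
Definition quat_norm_form (q : Q) : F :=
  let: Quaternion a b c d := q in
  a ^+ 2 + a * b - alpha * b ^+ 2 - beta * (c ^+ 2 + c * d - alpha * d ^+ 2).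

Definition oct_trace (u : O) : F :=
  Defs.coef1 (oct_fst u) + (Defs.coef1 (oct_fst u) + coefx (oct_fst u)).

Definition oct_norm (u : O) : F :=
  quat_norm_form (oct_fst u) - gamma * quat_norm_form (oct_snd u).

Ltac oct_coords :=
  repeat match goal with
  | u : octonion _ _ _ |- _ => case: u => [[? ? ? ?] [? ? ? ?]]
  end.
Ltac oct_ring :=
  oct_coords; rewrite /na_mul /oct_trace /oct_norm /=;
  first [ ring | by apply: oct_eq; apply: quat_eq => /=; ring ].

Lemma oct_traceD (u v : O) : oct_trace (u + v) = oct_trace u + oct_trace v.
Proof. by oct_ring. Qed.

Lemma oct_traceZ k (u : O) : oct_trace (k *: u) = k * oct_trace u.
Proof. by oct_ring. Qed.

Lemma oct_trace1 : oct_trace na_one = 2.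
Proof. by rewrite /oct_trace /=; ring. Qed.

(** The polar form of the norm is [T (u v^sigma)], where [v^sigma = T v - v] is the conjugate. *)
Lemma oct_normD (u v : O) :
  oct_norm (u + v) = oct_norm u + oct_norm v
    + (oct_trace u * oct_trace v - oct_trace (na_mul u v)).
Proof. by oct_ring. Qed.

Lemma oct_sqr (u : O) :
  na_mul u u = oct_trace u *: u - oct_norm u *: na_one.
Proof. by oct_ring. Qed.

(** Polarization of [oct_sqr]. *)
Lemma oct_mul_sym (u v : O) :
  na_mul u v + na_mul v u = oct_trace u *: v + oct_trace v *: u
    - (oct_trace u * oct_trace v - oct_trace (na_mul u v)) *: na_one.
Proof. by oct_ring. Qed.

Lemma oct_mul_alt_l (u v : O) : na_mul u (na_mul u v) = na_mul (na_mul u u) v.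
Proof. by oct_ring. Qed.

Lemma oct_mul_alt_r (u v : O) : na_mul (na_mul u v) v = na_mul u (na_mul v v).
Proof. by oct_ring. Qed.

Lemma oct_mul_flex (u v : O) : na_mul u (na_mul v u) = na_mul (na_mul u v) u.
Proof. by oct_ring. Qed.

Lemma oct_trace_mulA (u v w : O) :
  oct_trace (na_mul (na_mul u v) w) = oct_trace (na_mul u (na_mul v w)).
Proof. by oct_ring. Qed.

Lemma oct_normM (u v : O) :
  oct_norm (na_mul u v) = oct_norm u * oct_norm v.
Proof. by oct_ring. Qed.

(** By [oct_sqr] and its polarization, [x^2 = x + d], [y^2 = b] and [y x = y - x y]. The alternative
    and flexible laws, which stand in for associativity, and the multiplicativity of the norm then
    give the whole multiplication table of [1, x, y, x y], which is that of [quaternion d b]. *)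
Lemma oct_contains_quaternion (char2 : 2%N \in [pchar F])
    (x y : O) (d b : F) : b != 0 ->
    oct_trace x = 1 -> oct_norm x = - d ->
    oct_trace y = 0 -> oct_norm y = - b -> oct_trace (na_mul x y) = 0 ->
  contains_subalgebra O (assoc_na (quaternion d b)).
Proof.
move=> b0 tx nx ty ny txy; pose p := na_mul x y.
have xx : na_mul x x = x + d *: na_one.
  by rewrite oct_sqr tx nx scale1r scaleNr opprK.
have yy : na_mul y y = b *: na_one.
  by rewrite oct_sqr ty ny scale0r add0r scaleNr opprK.
have yx : na_mul y x = y - p.
  have := oct_mul_sym x y.
  rewrite tx ty txy scale1r scale0r !mulr0 subr0 scale0r.
  by rewrite subr0 addr0 => e; apply: (addrI p); rewrite e addrC subrK.
have xp : na_mul x p = p + d *: y.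
  by rewrite oct_mul_alt_l xx na_mulDl -na_scaleAl na_mul1l.
have py : na_mul p y = b *: x.
  by rewrite oct_mul_alt_r yy -na_scaleAr na_mul1r.
have yp : na_mul y p = b *: na_one - b *: x.
  rewrite oct_mul_flex yx na_mulDl -scaleN1r -na_scaleAl py yy.
  by rewrite scaleN1r.
have px : na_mul p x = - (d *: y).
  rewrite -oct_mul_flex yx na_mulDr -scaleN1r -na_scaleAr xp.
  by rewrite scaleN1r opprD addNKr.
have pp : na_mul p p = - (d * b) *: na_one.
  by rewrite oct_sqr txy oct_normM nx ny scale0r add0r mulrNN scaleNr.
pose f (q : assoc_na (quaternion d b)) : O :=
  Defs.coef1 q *: na_one + coefx q *: x + coefy q *: y + coefxy q *: p.
have flin : linear f.
  by move=> k [????] [????]; rewrite /f; oct_coords;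
     apply: oct_eq; apply: quat_eq => /=; ring.
have fD q r : f (q + r) = f q + f r by rewrite -(scale1r q) flin !scale1r.
have f0 : f 0 = 0 by rewrite /f !scale0r !addr0.
have fZ k q : f (k *: q) = k *: f q by rewrite -[k *: q]addr0 flin f0 addr0.
have f1 : f na_one = na_one by rewrite /f /= !scale0r scale1r !addr0.
have fx : f (quatx d b) = x by rewrite /f /= !scale0r scale1r !(add0r, addr0).
have fy : f (quaty d b) = y by rewrite /f /= !scale0r scale1r !(add0r, addr0).
have fp : f (Quaternion d b 0 0 0 1) = p.
  by rewrite /f /= !scale0r scale1r !(add0r, addr0).
(* Left multiplication by [z] is linear, so it is enough to compare it on the basis [1, x, y, p]. *)
have fM_gen z z' : f z' = z ->
    na_mul z x = f (z' * quatx d b) -> na_mul z y = f (z' * quaty d b) ->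
    na_mul z p = f (z' * Quaternion d b 0 0 0 1) ->
    forall q, na_mul z (f q) = f (z' * q).
  move=> fz zx zy zp [c0 c1 c2 c3]; rewrite {1}/f !na_mulDr -!na_scaleAr /=.
  rewrite zx zy zp na_mul1r -fz -!fZ -!fD; congr f.
  by case: z' {fz zx zy zp} => [????]; apply: quat_eq => /=; ring.
have fxM : forall q, na_mul x (f q) = f (quatx d b * q).
  apply: fM_gen => //.
  - by rewrite xx -fx -f1 -fZ -fD; congr f; apply: quat_eq => /=; ring.
  - by rewrite -/p -fp; congr f; apply: quat_eq => /=; ring.
  - by rewrite xp -fp -fy -fZ -fD; congr f; apply: quat_eq => /=; ring.
have fyM : forall q, na_mul y (f q) = f (quaty d b * q).
  apply: fM_gen => //.
  - rewrite yx -fy -fp -scaleN1r -fZ -fD; congr f.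
    by apply: quat_eq => /=; ring.
  - by rewrite yy -f1 -fZ; congr f; apply: quat_eq => /=; ring.
  - rewrite yp -f1 -fx -scaleNr -!fZ -fD; congr f.
    by apply: quat_eq => /=; ring.
have fpM : forall q, na_mul p (f q) = f (Quaternion d b 0 0 0 1 * q).
  apply: fM_gen => //.
  - by rewrite px -fy -scaleNr -fZ; congr f; apply: quat_eq => /=; ring.
  - by rewrite py -fx -fZ; congr f; apply: quat_eq => /=; ring.
  - by rewrite pp -f1 -fZ; congr f; apply: quat_eq => /=; ring.
have fM q r : f (na_mul q r) = na_mul (f q) (f r).
  rewrite {2}/f !na_mulDl -!na_scaleAl na_mul1l fxM fyM fpM -!fZ -!fD; congr f.
  by case: q r => [????] [????]; apply: quat_eq => /=; ring.
(* [f] is injective: an element of its kernel is orthogonal to everything for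
   the trace form of the quaternion algebra, which is nondegenerate. *)
apply/contains_subalgebraP; exists f => //.
have two0 : 2 = 0 :> F := pcharf0 char2.
have tf (q : assoc_na (quaternion d b)) : oct_trace (f q) = coefx q.
  by rewrite /f !oct_traceD !oct_traceZ oct_trace1 tx ty txy two0; ring.
have f_ker q : f q = 0 -> q = 0.
  move=> fq; have tq r : coefx (q * r : quaternion d b) = 0.
    rewrite -(tf (na_mul q r)) fM fq -(scale0r 0) -na_scaleAl.
    by rewrite oct_traceZ mul0r.
  case: q fq tq => [c0 c1 c2 c3] _ tq.
  (* Pairing with [1], [x], [y] and [x y] gives [c1], [c0 + c1], [b c3] and [- b c2]. *)
  have c10 : c1 = 0 by rewrite -(tq 1) /=; ring.
  have c00 : c0 = 0 by rewrite -(tq (quatx d b)) /= c10; ring.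
  have c30 : c3 = 0.
    apply: (mulfI b0); rewrite mulr0.
    by rewrite -(tq (quaty d b)) /=; ring.
  have c20 : c2 = 0.
    apply: (mulfI b0); rewrite mulr0 -oppr0.
    by rewrite -(tq (Quaternion d b 0 0 0 1)) /= c10 c00 c30; ring.
  by rewrite c10 c20 c30 c00.
move=> q r fqr; apply/eqP; rewrite -subr_eq0; apply/eqP/f_ker.
by rewrite -scaleN1r addrC flin fqr scaleN1r addNr.
Qed.

End OctonionTraceNorm.

(** * Spanning set and linear functionals of a biquadratic extension *)

(** In a polynomial in [w], the even powers of [w] lie in [E] and the odd ones in [E w]. *)
Lemma Fadjoin_sqrP (F : fieldType) (K : fieldExtType F) (E : {subfield K})
    (w k : K) :
    w ^+ 2 \in E -> k \in <<E; w>>%VS ->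
  exists e : K * K, [/\ e.1 \in E, e.2 \in E & k = e.1 + e.2 * w].
Proof.
move=> w2E /Fadjoin_polyP[p /polyOverP pE ->]; rewrite horner_coef.
elim/big_ind: _ => [|_ _ [e [e1 e2 ->]] [e' [e1' e2' ->]]|i _].
- exists (0, 0); split; rewrite /= ?mem0v ?mul0r ?addr0 //.
- exists (e.1 + e'.1, e.2 + e'.2); split; rewrite /= ?rpredD //; ring.
- have w2i : p`_i * (w ^+ 2) ^+ i./2 \in E by rewrite rpredM ?(rpredX _ w2E).
  have ->: w ^+ i = w ^+ odd i * (w ^+ 2) ^+ i./2.
    by rewrite -exprM mul2n -exprD odd_double_half.
  case: (odd i).
  - exists (0, p`_i * (w ^+ 2) ^+ i./2); split; rewrite /= ?mem0v //.
    by rewrite expr1 add0r -mulrA [w * _]mulrC.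
  - exists (p`_i * (w ^+ 2) ^+ i./2, 0); split; rewrite /= ?mem0v //.
    by rewrite mul0r mul1r addr0.
Qed.

Lemma biquadratic_span (F : fieldType) (K : fieldExtType F) (b c : F)
    (u v : K) :
    u ^+ 2 = b%:A -> v ^+ 2 = c%:A -> <<<<1; u>>; v>>%VS = {:K}%VS ->
  span [:: 1; u; v; u * v] = {:K}%VS.
Proof.
move=> u2 v2 Kuv; apply/eqP; rewrite eqEsubv subvf; apply/subvP=> k _.
have : k \in <<<<1; u>>; v>>%VS by rewrite Kuv memvf.
have scE (E : {subfield K}) (a : F) : a%:A \in E by rewrite rpredZ ?mem1v.
case/Fadjoin_sqrP=> [|[e e'] [/= eE e'E ->]]; first by rewrite v2 scE.
have in1u e0 : e0 \in <<1; u>>%VS -> exists p q : F, e0 = p%:A + q *: u.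
  case/Fadjoin_sqrP=> [|[_ _] [/= /vlineP[p ->] /vlineP[q ->] ->]].
    by rewrite u2 scE.
  by exists p, q; rewrite -scalerAl mul1r.
have [[p [q ->]] [r [s ->]]] := (in1u _ eE, in1u _ e'E).
rewrite mulrDl -!scalerAl mul1r.
by rewrite !rpredD ?rpredZ // memv_span // !inE eqxx ?orbT.
Qed.

(* The trace form [(m, k) |-> psi (m * k)] of a nonzero functional on a field
   is nondegenerate. *)
Lemma functional_interpolation (F : fieldType) (K : fieldExtType F)
    (psi : {scalar K}) (n : nat) (B : n.-tuple K) (c : 'I_n -> F) :
    psi 1 != 0 -> n = \dim {:K} -> <<B>>%VS = {:K}%VS ->
  exists m : K, forall i, psi (m * tnth B i) = c i.
Proof.
move=> psi1 dimK spanB.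
pose M (m : K) : 'rV[F]_n := \row_i psi (m * tnth B i).
have Mlin : linear M.
  by move=> a k l; apply/rowP=> i; rewrite !mxE mulrDl -scalerAl linearP.
pose ML := GRing.isLinear.Build F K 'rV[F]_n _ M Mlin.
pose Mf : {linear K -> 'rV[F]_n} := HB.pack M ML.
pose f := linfun Mf.
have kerf : lker f = 0%VS.
  apply/eqP; rewrite -subv0; apply/subvP=> m; rewrite memv_ker memv0 lfunE /=.
  move/eqP=> /rowP Mm0; apply: contraT => m0; case/negP: psi1.
  (* Expanding [m^-1] in [B] turns [psi (m * m^-1)] into a combination of the zero values
     [psi (m * B_i)]. *)
  rewrite -(mulfV m0).
  have : m^-1 \in <<B>>%VS by rewrite spanB memvf.
  move=> /coord_span ->; rewrite mulr_sumr linear_sum big1 //= => i _.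
  rewrite -scalerAr linearZ -tnth_nth.
  by have := Mm0 i; rewrite !mxE => /= ->; rewrite mulr0.
(* An injective linear map between spaces of the same dimension [n] is onto. *)
have limgf : (f @: {:K})%VS = {: 'rV[F]_n}%VS.
  apply/eqP; rewrite eqEdim subvf limg_dim_eq ?kerf ?capv0 // -dimK.
  by rewrite dimvf /dim /= mul1n.
have /memv_imgP[m _ mc] : \row_i c i \in (f @: {:K})%VS by rewrite limgf memvf.
exists m => i; have := congr1 (fun w : 'rV_n => w 0 i) mc.
by rewrite lfunE /= !mxE.
Qed.

(** * Quaternion subalgebras obtained from a biquadratic subfield *)

(** If [T w] were nonzero, [w^2 = T w w - N w] would make [w] a scalar, and scalars have trace 0 in
    characteristic 2. *)
Lemma oct_trace_sqrt (F : fieldType) (char2 : 2%N \in [pchar F])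
    (alpha beta gamma : F) (w : octonion alpha beta gamma) (d : F) :
  na_mul w w = d *: na_one -> oct_trace w = 0 /\ oct_norm w = - d.
Proof.
have two0 : 2 = 0 :> F := pcharf0 char2.
move=> ww; have := oct_sqr w; rewrite ww => e.
have tw : oct_trace w = 0.
  apply/eqP; apply: contraT => tw0.
  have w1 : w = ((oct_trace w)^-1 * (d + oct_norm w)) *: na_one.
    by rewrite -scalerA scalerDl e subrK scalerA mulVf // scale1r.
  by case/negP: tw0; rewrite w1 oct_traceZ oct_trace1 two0 mulr0.
split=> //; move: e; rewrite tw scale0r add0r -scaleNr.
move=> /(congr1 (fun u => Defs.coef1 (oct_fst u))) /=.
by rewrite !mulr1 => ->; rewrite opprK.
Qed.

(** The order of the quantifiers matters: [n] depends on the algebra and on [p], [q], while [r] and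
    [s] stay free, to be chosen once the [n] of all three algebras are known. *)
Lemma oct_biquadratic_quaternions (F : fieldType) (char2 : 2%N \in [pchar F])
    (alpha beta gamma : F) (K : fieldExtType F) (b c : F) (u v : K)
    (p q : F) :
    b != 0 -> \dim {:K} = 4 -> u ^+ 2 = b%:A -> v ^+ 2 = c%:A ->
    <<<<1; u>>; v>>%VS = {:K}%VS ->
    contains_subalgebra (octonion alpha beta gamma) (assoc_na K) ->
  exists n : F, forall r s : F,
    contains_subalgebra (octonion alpha beta gamma)
      (assoc_na (quaternion (n + r * p + s * q + c * (r ^+ 2 + b * s ^+ 2)) b)).
Proof.
move=> b0 dimK u2 v2 Kuv /contains_subalgebraP[f [flin f1 fM] _].
have two0 : 2 = 0 :> F := pcharf0 char2.
have oppF (a : F) : - a = a by rewrite (oppr_pchar2 char2).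
(* Any element of trace 1 would do: it makes [psi 1] nonzero. *)
pose x : octonion alpha beta gamma := Octonion gamma (quatx alpha beta) 0.
pose psi (k : K) : F := oct_trace (na_mul x (f k)).
have psilin : scalar psi.
  by move=> k l m; rewrite /psi flin na_mulDr -na_scaleAr oct_traceD oct_traceZ.
pose psiL := GRing.isLinear.Build F K F _ psi psilin.
pose psif : {scalar K} := HB.pack psi psiL.
have psi1 : psif 1 != 0.
  rewrite /= /psi f1 na_mul1r /oct_trace /= !add0r; exact: oner_neq0.
pose B := [tuple 1; u; v; u * v].
pose t := [tuple 1; 0; p; q].
have [m mt] := functional_interpolation (tnth t) psi1 (esym dimK)
                 (biquadratic_span u2 v2 Kuv : <<B>>%VS = _).
pose a := na_mul x (f m).
(* The trace is associative, so multiplying [x] by [f m] amounts to replacing [psi] by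
   [psi (m * _)]. *)
have ta k : oct_trace (na_mul a (f k)) = psi (m * k).
  by rewrite oct_trace_mulA -fM.
have ta1 : oct_trace a = 1.
  by rewrite -[a]na_mul1r -f1 ta; exact: (mt (@Ordinal 4 0 isT)).
have tau : oct_trace (na_mul a (f u)) = 0.
  by rewrite ta; exact: (mt (@Ordinal 4 1 isT)).
have tav : oct_trace (na_mul a (f v)) = p.
  by rewrite ta; exact: (mt (@Ordinal 4 2 isT)).
have tauv : oct_trace (na_mul a (f (u * v))) = q.
  by rewrite ta; exact: (mt (@Ordinal 4 3 isT)).
have fD k l : f (k + l) = f k + f l by rewrite -(scale1r k) flin !scale1r.
have f0 : f 0 = 0.
  by apply: (addrI (f 0)); rewrite -fD !addr0.
have fZ h k : f (h *: k) = h *: f k by rewrite -[h *: k]addr0 flin f0 addr0.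
have trK k d : k ^+ 2 = d%:A -> oct_trace (f k) = 0 /\ oct_norm (f k) = - d.
  by move=> k2; apply: (oct_trace_sqrt char2); rewrite -fM -f1 -fZ -k2.
exists (oct_norm a) => r s; pose k := r *: v + s *: (u * v).
have k2 : k ^+ 2 = (c * (r ^+ 2 + b * s ^+ 2))%:A.
  have twoK : 2 = 0 :> K by rewrite -(rmorph_nat (in_alg K)) two0 rmorph0.
  rewrite /k -(mulr_algl r) -(mulr_algl s).
  transitivity (r%:A ^+ 2 * v ^+ 2 + s%:A ^+ 2 * (u ^+ 2 * v ^+ 2)
                + 2 * (r%:A * s%:A * u * v ^+ 2)); first by ring.
  rewrite u2 v2 twoK mul0r addr0 -!(in_algE K) !(rmorphM, rmorphD, rmorphXn) /=.
  by ring.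
have uv2 : (u * v) ^+ 2 = (b * c)%:A.
  by rewrite exprMn u2 v2 -!(in_algE K) rmorphM.
have [tv _] := trK _ _ v2; have [tuv _] := trK _ _ uv2.
have [tu nu] := trK _ _ u2; have [tk nk] := trK _ _ k2.
(* Multiplication by [u] preserves the span of [v] and [u v], on whose image the trace vanishes. *)
have tku : oct_trace (na_mul (f k) (f u)) = 0.
  have ku : k * u = (s * b) *: v + r *: (u * v).
    rewrite /k mulrDl -!scalerAl mulrAC -expr2 u2 mulr_algl scalerA addrC.
    by rewrite [v * u]mulrC.
  have -> : na_mul (f k) (f u) = (s * b) *: f v + r *: f (u * v).
    by rewrite -fM -!fZ -fD -ku.
  by rewrite oct_traceD !oct_traceZ tv tuv !mulr0 addr0.
apply: (oct_contains_quaternion char2 (x := a + f k) (y := f u)) => //.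
- by rewrite oct_traceD ta1 tk addr0.
(* As [T k = 0], the norm is [N a + N k - T (a k)], with [T (a k) = r p + s q] and [N k = - k^2];
   signs disappear in characteristic 2. *)
- rewrite oct_normD nk tk mulr0 sub0r /k fD !fZ na_mulDr -!na_scaleAr.
  by rewrite oct_traceD !oct_traceZ tav tauv !oppF; ring.
- by rewrite na_mulDl oct_traceD tau tku addr0.
Qed.

(** * The quaternion algebra common to the three octonion algebras *)

Theorem mainTheorem5 (F : fieldType) (char2 : 2%N \in [pchar F])
    (A : 'I_3 -> naAlgType F)
    (octA : forall i : 'I_3, is_octonion_algebra (A i)) :
  (exists K : fieldExtType F,
     is_biquadratic_insep K /\ shares A (assoc_na K)) ->
  exists B : naAlgType F, is_quaternion_algebra B /\ shares A B.
Proof.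
move=> [K [[dimK [b [c [u [v [b0 _ u2 v2 Kuv]]]]]] AK]].
have quatA (i : 'I_3) (p q : F) : exists n : F, forall r s : F,
    contains_subalgebra (A i)
      (assoc_na (quaternion (n + r * p + s * q + c * (r ^+ 2 + b * s ^+ 2)) b)).
  have [alpha [beta [gamma [_ _ isoA]]]] := octA i.
  have /(contains_subalgebra_iso _ isoA) := AK i.
  case/(oct_biquadratic_quaternions char2 p q b0 dimK u2 v2 Kuv) => n nP.
  by exists n => r s; apply/(contains_subalgebra_iso _ isoA).
have [n0 quat0] := quatA 0 0 0.
have [n1 quat1] := quatA 1 1 0.
have [n2 quat2] := quatA 2 0 1.
(* Up to a common term, the first parameters of the three quaternion algebras are [n0], [n1 + r] and
   [n2 + s]; these values make them equal. *)
pose r := n0 - n1; pose s := n0 - n2.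
pose d := n0 + c * (r ^+ 2 + b * s ^+ 2).
exists (assoc_na (quaternion d b)); split.
  exists d, b; split=> //; exists id.
  by split; [split=> // k x y | exists id].
case=> [[|[|[|//]]] lti].
- have -> : Ordinal lti = 0 by apply: val_inj.
  by move: (quat0 r s); rewrite !mulr0 !addr0.
- have -> : Ordinal lti = 1 by apply: val_inj.
  by move: (quat1 r s); rewrite mulr0 mulr1 addr0 [n1 + _]addrC subrK.
- have -> : Ordinal lti = 2 by apply: val_inj.
  by move: (quat2 r s); rewrite mulr0 mulr1 addr0 [n2 + _]addrC subrK.
Qed.
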